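(* Let $B$ be a ring, let $\mathcal{C}$ be a closed subcategory of the category $\mathsf{Mod}_B$ of right $B$-modules, with associated preradical $\mathfrak{r}:\mathsf{Mod}_B\to\mathcal{C}$, and let $\mathfrak{a}=\mathfrak{r}(B_B)$. Assume that $\mathfrak{r}$ is exact, and let $M\in\mathcal{C}$, with injective hull $E_{\mathcal{C}}(M)$ in the Grothendieck category $\mathcal{C}$. The map $$\zeta_M: M\to \mathrm{Hom}_B(\mathfrak{a},E_{\mathcal{C}}(M)),\qquad \zeta_M(m)(a)=ma\quad (m\in M,\ a\in\mathfrak{a}),$$ gives an injective envelope of $M$ in $\mathsf{Mod}_B$. As a consequence, $M$ is injective in $\mathsf{Mod}_B$ if and only if $M$ is injective in $\mathcal{C}$ and $\zeta_M$ is an isomorphism.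
   Context: A full subcategory $\mathcal{C}$ of $\mathsf{Mod}_B$ is closed if submodules, quotients and arbitrary direct sums of objects of $\mathcal{C}$ are in $\mathcal{C}$. Its associated preradical $\mathfrak{r}$ sends a right $B$-module $X$ to its largest submodule $\mathfrak{r}(X)$ belonging to $\mathcal{C}$. $\mathfrak{a}=\mathfrak{r}(B_B)$ is a two-sided ideal of $B$, and $\mathrm{Hom}_B(\mathfrak{a},N)$ (right $B$-linear maps) is a right $B$-module via $(fb)(x)=f(bx)$. $M$ is regarded as a submodule of $E_{\mathcal{C}}(M)$. *)

(* Defs.v *)
From HB Require Import structures.
From mathcomp Require Import all_boot all_order all_algebra.
From mathcomp Require Import boolp classical_sets functions cardinality fsbigop.

Set Implicit Arguments.
Unset Strict Implicit.
Unset Printing Implicit Defensive.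

Import GRing.Theory.
Local Open Scope ring_scope.

(* A right B-module is a left module over the converse ring B^c, so that
   [b *: x] stands for x b. The right regular module B_B is [(B^c)^o]. *)
Notation rmodType B := (lmodType B^c).
Notation rregular B := ((B^c)^o : rmodType B).

Definition surjective (X Y : Type) (f : X -> Y) := forall y, exists x, f x = y.

Section Submodule.
Variables (R : pzRingType) (V : lmodType R) (S : submodClosed V).

Record submod := Submod { submod_val : V; submod_valP : submod_val \in S }.

HB.instance Definition _ := [isSub for submod_val].
HB.instance Definition _ := [Choice of submod by <:].
HB.instance Definition _ := [SubChoice_isSubLmodule of submod by <:].

End Submodule.

Section DirectSum.
Variables (R : pzRingType) (I : Type) (X : I -> lmodType R).

Record dsum := DSum {
  dsum_fun :> forall i, X i ;
  dsum_finite : `[< finite_set [set i | dsum_fun i != 0]%classic >] }.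

HB.instance Definition _ := [isSub for dsum_fun].
HB.instance Definition _ := [Choice of dsum by <:].

Lemma dsum_ext (f g : dsum) : (forall i, f i = g i) -> f = g.
Proof. by move=> fg; apply/val_inj/functional_extensionality_dep. Qed.

Fact dsum_zero_subproof :
  `[< finite_set [set i | (0 : X i) != 0]%classic >].
Proof.
by apply/asboolP; apply: (sub_finite_set _ (finite_set0 I)) => i /=; rewrite eqxx.
Qed.

Fact dsum_opp_subproof (f : dsum) :
  `[< finite_set [set i | - f i != 0]%classic >].
Proof.
apply/asboolP; move: (asboolP _ (dsum_finite f)); apply: sub_finite_set => i /=.
by rewrite oppr_eq0.
Qed.

Fact dsum_add_subproof (f g : dsum) :
  `[< finite_set [set i | f i + g i != 0]%classic >].
Proof.
apply/asboolP; have fin := (asboolP _ (dsum_finite f), asboolP _ (dsum_finite g)).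
have /sub_finite_set : ([set i | f i + g i != 0] `<=`
  [set i | f i != 0%R] `|` [set i | g i != 0%R])%classic.
  move=> i /= fgi; have [fi|] := eqVneq (f i) 0; last by left.
  by right; move: fgi; rewrite fi add0r.
by apply; rewrite finite_setU; split; case: fin.
Qed.

Fact dsum_scale_subproof (c : R) (f : dsum) :
  `[< finite_set [set i | c *: f i != 0]%classic >].
Proof.
apply/asboolP; move: (asboolP _ (dsum_finite f)); apply: sub_finite_set => i /=.
by apply: contra_neq => ->; rewrite scaler0.
Qed.

Let add f g := DSum (dsum_add_subproof f g).
Let opp f := DSum (dsum_opp_subproof f).
Let scale c f := DSum (dsum_scale_subproof c f).

Fact dsum_addA : associative add.
Proof. by move=> f g h; apply: dsum_ext => i; exact: addrA. Qed.
Fact dsum_addC : commutative add.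
Proof. by move=> f g; apply: dsum_ext => i; exact: addrC. Qed.
Fact dsum_add0 : left_id (DSum dsum_zero_subproof) add.
Proof. by move=> f; apply: dsum_ext => i; exact: add0r. Qed.
Fact dsum_addN : left_inverse (DSum dsum_zero_subproof) opp add.
Proof. by move=> f; apply: dsum_ext => i; exact: addNr. Qed.

HB.instance Definition _ :=
  GRing.isZmodule.Build dsum dsum_addA dsum_addC dsum_add0 dsum_addN.

Fact dsum_scaleA a b f : scale a (scale b f) = scale (a * b) f.
Proof. by apply: dsum_ext => i; exact: scalerA. Qed.
Fact dsum_scale1 : left_id 1 scale.
Proof. by move=> f; apply: dsum_ext => i; exact: scale1r. Qed.
Fact dsum_scaleDr : right_distributive scale +%R.
Proof. by move=> a f g; apply: dsum_ext => i; exact: scalerDr. Qed.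
Fact dsum_scaleDl f : {morph scale^~ f : a b / a + b}.
Proof. by move=> a b; apply: dsum_ext => i; exact: scalerDl. Qed.

HB.instance Definition _ := GRing.Zmodule_isLmodule.Build R dsum
  dsum_scaleA dsum_scale1 dsum_scaleDr dsum_scaleDl.

End DirectSum.

Section DirectSumMap.
Variables (R : pzRingType) (I : Type) (X : I -> lmodType R) (Y : lmodType R).
Variable g : forall i, {linear X i -> Y}.

Definition dsum_map (f : dsum X) : Y :=
  \sum_(i \in [set: {classic I}]) g (i : I) (f i).

Lemma dsum_mapE (A : set {classic I}) (f : dsum X) : finite_set A ->
    (forall i, ~ A i -> f i = 0) ->
  dsum_map f = \sum_(i \in A) g (i : I) (f i).
Proof.
move=> finA A0; apply/esym/fsbig_widen => // i [_ /A0 fi] /=.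
by rewrite fi linear0.
Qed.

Fact dsum_map_linear : linear dsum_map.
Proof.
move=> c f h.
pose A : set {classic I} :=
  ([set i | f i != 0%R] `|` [set i | h i != 0%R])%classic.
have finA : finite_set A.
  by rewrite finite_setU; split;
    [exact: (asboolP _ (dsum_finite f)) | exact: (asboolP _ (dsum_finite h))].
have A0 i : ~ A i -> f i = 0 /\ h i = 0.
  move=> nAi; have [fi|fi] := eqVneq (f i) 0; last by case: nAi; left.
  by have [hi|hi] := eqVneq (h i) 0; last by case: nAi; right.
rewrite (dsum_mapE finA) => [|i /A0[fi hi]]; last first.
  by change (c *: f i + h i = 0); rewrite fi hi scaler0 addr0.
rewrite (dsum_mapE (f := f) finA) => [|i /A0[]//].
rewrite (dsum_mapE (f := h) finA) => [|i /A0[]//].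
rewrite !fsbig_finite//= scaler_sumr -big_split/=.
by apply: eq_bigr => i _; rewrite -linearP.
Qed.

HB.instance Definition _ := GRing.isLinear.Build R (dsum X) Y _ dsum_map
  dsum_map_linear.

Lemma dsum_map_ge i (x : X i) : exists f : dsum X, dsum_map f = g i x.
Proof.
pose F j := if pselect (i = j) is left e then eq_rect i X x j e else 0.
have F0 j : i <> j -> F j = 0 by rewrite /F; case: pselect.
have finF : `[< finite_set [set j | F j != 0]%classic >].
  apply/asboolP; apply: (sub_finite_set _ (finite_set1 (i : {classic I}))).
  by move=> j /=; apply: contra_neqP => /nesym /F0.
exists (DSum finF); rewrite (dsum_mapE (finite_set1 (i : {classic I}))).
  rewrite fsbig_set1 /= /F; case: pselect => // e.
  by rewrite (Prop_irrelevance e erefl).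
by move=> j /= /nesym /F0.
Qed.

End DirectSumMap.

Section Image.
Variables (R : pzRingType) (X Y : lmodType R) (f : {linear X -> Y}).

Definition im : {pred Y} := fun y => `[< exists x, f x = y >].

Lemma imP y : reflect (exists x, f x = y) (y \in im).
Proof. exact: asboolP. Qed.

Fact im_submod_closed : submod_closed im.
Proof.
split; first by apply/imP; exists 0; rewrite linear0.
move=> c _ _ /imP[x <-] /imP[y <-]; apply/imP; exists (c *: x + y).
by rewrite linearP.
Qed.
HB.instance Definition _ := GRing.isSubmodClosed.Build R Y im im_submod_closed.

Definition to_im (x : X) : submod im :=
  Submod (introT (imP (f x)) (ex_intro _ x erefl)).

Fact to_im_linear : linear to_im.
Proof. by move=> c x y; apply: val_inj; rewrite /= linearP. Qed.
HB.instance Definition _ := GRing.isLinear.Build R X (submod im) _ to_im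
  to_im_linear.

Lemma to_im_surj : surjective to_im.
Proof. by move=> [y yP]; have /imP[x xy] := yP; exists x; apply: val_inj. Qed.

End Image.

Definition short_exact (R : pzRingType) (X Y Z : lmodType R)
    (f : {linear X -> Y}) (g : {linear Y -> Z}) :=
  [/\ injective f, (forall y, g y = 0 <-> exists x, f x = y) & surjective g].

(* A full subcategory is given by its objects. Submodules and quotients are
   taken up to isomorphism, as sources of injective, resp. targets of
   surjective, linear maps. *)
Record closedSubcat (B : pzRingType) := ClosedSubcat {
  in_subcat :> rmodType B -> Prop ;
  subcat_sub : forall (X Y : rmodType B) (f : {linear X -> Y}),
    injective f -> in_subcat Y -> in_subcat X ;
  subcat_quo : forall (X Y : rmodType B) (f : {linear X -> Y}),
    surjective f -> in_subcat X -> in_subcat Y ;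
  subcat_dsum : forall (I : Type) (X : I -> rmodType B),
    (forall i, in_subcat (X i)) -> in_subcat (dsum X) }.

Section Preradical.
Variables (B : pzRingType) (C : closedSubcat B).

(* The union of the submodules of X that belong to C; by [rad_in] and
   [rad_largest] it is the largest of them. *)
Definition rad (X : rmodType B) : {pred X} :=
  fun x => `[< exists S : submodClosed X, C (submod S) /\ x \in S >].
Arguments rad : clear implicits.

Lemma radP (X : rmodType B) x :
  reflect (exists S : submodClosed X, C (submod S) /\ x \in S) (x \in rad X).
Proof. exact: asboolP. Qed.

Lemma im_in (X Y : rmodType B) (f : {linear X -> Y}) :
  C X -> C (submod (im f)).
Proof. exact/subcat_quo/to_im_surj. Qed.

Let rad_dsum_map (X : rmodType B) : {linear dsum _ -> X} :=
  @dsum_map B^c {S : submodClosed X | C (submod S)}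
    (fun S => submod (sval S)) X (fun S => val).

Let rad_im (X : rmodType B) : rad X =i im (rad_dsum_map X).
Proof.
move=> x; apply/radP/imP => [[S [CS Sx]]|[f <-]].
  have [f fE] := @dsum_map_ge B^c {S : submodClosed X | C (submod S)}
    (fun S => submod (sval S)) X (fun S => val) (exist _ S CS) (Submod Sx).
  by exists f; exact: fE.
pose T : submodClosed X := GRing.SubmodClosed.clone _ _ (im (rad_dsum_map X)) _.
exists T; split; last by apply/imP; exists f.
by apply: im_in; apply: subcat_dsum => -[].
Qed.

Fact rad_submod_closed (X : rmodType B) : submod_closed (rad X).
Proof.
have [im0 imD] := im_submod_closed (rad_dsum_map X).
split; first by rewrite rad_im.
by move=> c x y; rewrite !rad_im; exact: imD.
Qed.
HB.instance Definition _ (X : rmodType B) :=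
  GRing.isSubmodClosed.Build B^c X (rad X) (rad_submod_closed X).

Lemma rad_in (X : rmodType B) : C (submod (rad X)).
Proof.
have Cim : C (submod (im (rad_dsum_map X))).
  by apply: im_in; apply: subcat_dsum => -[].
have sub (x : submod (rad X)) : val x \in im (rad_dsum_map X).
  by rewrite -rad_im; exact: submod_valP.
pose h x : submod (im (rad_dsum_map X)) := Submod (sub x).
have hlin : linear h by move=> c x y; apply: val_inj.
pose H := GRing.isLinear.Build _ _ _ _ h hlin.
pose hL : {linear submod (rad X) -> submod (im (rad_dsum_map X))} :=
  HB.pack h H.
apply: (subcat_sub (f := hL)) Cim => x y /(congr1 val) /= xy.
exact: val_inj.
Qed.

Lemma rad_largest (X : rmodType B) (S : submodClosed X) :
  C (submod S) -> {subset S <= rad X}.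
Proof. by move=> CS x Sx; apply/radP; exists S. Qed.

Section Functor.
Variables (X Y : rmodType B) (f : {linear X -> Y}).

Fact rad_map_subproof (x : submod (rad X)) : f (val x) \in rad Y.
Proof.
pose fr : {linear submod (rad X) -> Y} := f \o val.
have /imP im_x : exists x', fr x' = f (val x) by exists x.
by move: im_x; apply: rad_largest; exact/im_in/rad_in.
Qed.

Definition rad_map (x : submod (rad X)) : submod (rad Y) :=
  Submod (rad_map_subproof x).

Fact rad_map_linear : linear rad_map.
Proof. by move=> c x y; apply: val_inj; rewrite /= linearP. Qed.
HB.instance Definition _ := GRing.isLinear.Build B^c _ _ _ rad_map
  rad_map_linear.

End Functor.

(* As C is closed under submodules and quotients, exactness in C is exactness
   of the underlying modules. *)
Definition rad_exact :=
  forall (X Y Z : rmodType B) (f : {linear X -> Y}) (g : {linear Y -> Z}),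
    short_exact f g -> short_exact (rad_map f) (rad_map g).

End Preradical.
Arguments rad {B} C X.

Record ideal (B : pzRingType) := Ideal {
  ideal_submod :> submodClosed (rregular B) ;
  ideal_mull : forall b x : B, x \in ideal_submod -> b * x \in ideal_submod }.

Section HomIdeal.
Variables (B : pzRingType) (I : ideal B).

Definition ideal_lmul (b : B) (x : submod I) : submod I :=
  Submod (ideal_mull b (submod_valP x)).

Fact ideal_lmul_linear b : linear (ideal_lmul b).
Proof.
move=> c x y; apply: val_inj; rewrite /=.
by change (b * ((val x : B) * c + (val y : B)) = b * val x * c + b * val y :> B);
  rewrite mulrDr mulrA.
Qed.
HB.instance Definition _ b := GRing.isLinear.Build B^c _ _ _ (ideal_lmul b)
  (ideal_lmul_linear b).

Variable N : rmodType B.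

Record homI := HomI {
  homI_fun :> submod I -> N ; homI_linear : `[< linear homI_fun >] }.

HB.instance Definition _ := [isSub for homI_fun].
HB.instance Definition _ := [Choice of homI by <:].
HB.instance Definition _ (f : homI) :=
  GRing.isLinear.Build B^c (submod I) N _ f (asboolW (homI_linear f)).

Lemma homI_ext (f g : homI) : f =1 g -> f = g.
Proof. by move=> fg; apply/val_inj/funext. Qed.

Fact homI_zero_subproof : `[< linear (fun _ : submod I => 0 : N) >].
Proof. by apply/asboolP => c x y; rewrite scaler0 addr0. Qed.
Fact homI_opp_subproof (f : homI) : `[< linear (fun x => - f x) >].
Proof. by apply/asboolP => c x y; rewrite linearP opprD scalerN. Qed.
Fact homI_add_subproof (f g : homI) : `[< linear (fun x => f x + g x) >].
Proof. by apply/asboolP => c x y; rewrite !linearP scalerDr addrACA. Qed.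
Fact homI_scale_subproof (b : B^c) (f : homI) :
  `[< linear (fun x => f (ideal_lmul b x)) >].
Proof. by apply/asboolP => c x y; rewrite !linearP. Qed.

Let add f g := HomI (homI_add_subproof f g).
Let opp f := HomI (homI_opp_subproof f).
Let scale b f := HomI (homI_scale_subproof b f).

Fact homI_addA : associative add.
Proof. by move=> f g h; apply: homI_ext => x; exact: addrA. Qed.
Fact homI_addC : commutative add.
Proof. by move=> f g; apply: homI_ext => x; exact: addrC. Qed.
Fact homI_add0 : left_id (HomI homI_zero_subproof) add.
Proof. by move=> f; apply: homI_ext => x; exact: add0r. Qed.
Fact homI_addN : left_inverse (HomI homI_zero_subproof) opp add.
Proof. by move=> f; apply: homI_ext => x; exact: addNr. Qed.

HB.instance Definition _ :=
  GRing.isZmodule.Build homI homI_addA homI_addC homI_add0 homI_addN.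

Fact homI_scaleA a b f : scale a (scale b f) = scale (a * b) f.
Proof.
apply: homI_ext => x; congr (homI_fun f _); apply: val_inj.
exact: (@mulrA B).
Qed.
Fact homI_scale1 : left_id 1 scale.
Proof.
move=> f; apply: homI_ext => x; congr (homI_fun f _); apply: val_inj.
exact: (@mul1r B).
Qed.
Fact homI_scaleDr : right_distributive scale +%R.
Proof. by move=> a f g; apply: homI_ext. Qed.
Fact homI_scaleDl f : {morph scale^~ f : a b / a + b}.
Proof.
move=> a b; apply: homI_ext => x /=.
rewrite -[RHS](linearD f); congr (homI_fun f _); apply: val_inj.
exact: (@mulrDl B).
Qed.

HB.instance Definition _ := GRing.Zmodule_isLmodule.Build B^c homI
  homI_scaleA homI_scale1 homI_scaleDr homI_scaleDl.

Lemma homI_scaleE (b : B^c) (f : homI) x : (b *: f) x = f (ideal_lmul b x).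
Proof. by []. Qed.

End HomIdeal.

Fact rad_mull (B : pzRingType) (C : closedSubcat B) (b x : B) :
  x \in rad C (rregular B) -> b * x \in rad C (rregular B).
Proof.
move=> xrad; have lin : linear (fun y : rregular B => b * (y : B) : rregular B).
  by move=> c y z; change (b * ((y : B) * c + z) = b * y * c + b * z :> B);
    rewrite mulrDr mulrA.
pose H := GRing.isLinear.Build _ _ _ _ _ lin.
pose f : {linear rregular B -> rregular B} := HB.pack (fun y : B => b * y) H.
exact: (rad_map_subproof f (Submod xrad)).
Qed.

Definition rad_ideal (B : pzRingType) (C : closedSubcat B) : ideal B :=
  Ideal (@rad_mull B C).

Section Zeta.
Variables (B : pzRingType) (I : ideal B) (M E : rmodType B).
Variable u : {linear M -> E}.

Fact zeta_subproof (m : M) :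
  `[< linear (fun a : submod I => u ((val a : B^c) *: m)) >].
Proof. by apply/asboolP => c x y; rewrite /= scalerDl -scalerA linearP. Qed.

Definition zeta (m : M) : homI I E := HomI (zeta_subproof m).

Fact zeta_linear : linear zeta.
Proof.
move=> b m n; apply: homI_ext => x /=.
by rewrite scalerDr linearD scalerA.
Qed.
HB.instance Definition _ := GRing.isLinear.Build B^c M (homI I E) _ zeta
  zeta_linear.

End Zeta.

(* Injectivity and injective envelopes in the full subcategory of modules
   satisfying P. They are used when P is closed under submodules, so that the
   monomorphisms are the injective maps and the subobjects of E are its
   submodules. *)
Section Injective.
Variables (B : pzRingType) (P : rmodType B -> Prop).

Definition injective_in (E : rmodType B) :=
  P E /\ forall (X Y : rmodType B) (i : {linear X -> Y}) (f : {linear X -> E}),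
    P X -> P Y -> injective i ->
    exists g : {linear Y -> E}, forall x, g (i x) = f x.

Definition essential (M E : rmodType B) (u : {linear M -> E}) :=
  forall S : submodClosed E, (exists2 y, y \in S & y != 0) ->
    exists2 m, u m \in S & u m != 0.

Definition injective_envelope (M E : rmodType B) (u : {linear M -> E}) :=
  [/\ injective u, essential u & injective_in E].

End Injective.

Definition allMod (B : pzRingType) (_ : rmodType B) := True.

(* Main.v *)
From HB Require Import structures.
From mathcomp Require Import all_boot all_order all_algebra.
From mathcomp Require Import boolp.
Require Import Defs.

(* Exactness of the preradical, applied to the surjection B -> xB, shows that
   every x in an object of C satisfies x = xt for some t in the ideal a. Hence
   zeta is injective on objects of C. For f in Hom_B(a, E) and x in a, the
   module product f.x equals zeta_E(f(x)); so every nonzero submodule of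
   Hom_B(a, E) meets E, hence meets M. For injectivity, a map
   f : X -> Hom_B(a, E) sends r(X) into zeta_E(E), which gives a map r(X) -> E.
   It extends to g : r(Y) -> E since E is injective in C, and
   y |-> (t |-> g(yt)) extends f. *)

Set Implicit Arguments.
Unset Strict Implicit.
Unset Printing Implicit Defensive.

Import GRing.Theory.
Local Open Scope ring_scope.

Section Kernel.
Variables (R : pzRingType) (X Y : lmodType R) (f : {linear X -> Y}).

Definition ker : {pred X} := fun x => f x == 0.

Fact ker_submod_closed : submod_closed ker.
Proof.
split; first by rewrite unfold_in /ker linear0.
move=> c x y /eqP fx /eqP fy.
by rewrite unfold_in /ker linearP fx fy scaler0 addr0.
Qed.
HB.instance Definition _ :=
  GRing.isSubmodClosed.Build R X ker ker_submod_closed.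

Lemma kerP x : reflect (f x = 0) (x \in ker).
Proof. exact: eqP. Qed.

Lemma short_exact_ker :
  surjective f -> short_exact (val : {linear submod ker -> X}) f.
Proof.
move=> fsurj; split=> //; first exact: val_inj.
move=> x; split=> [/kerP kx|[[x' /kerP kx'] <-] //].
by exists (Submod kx).
Qed.

End Kernel.

Section Orbit.
Variables (R : pzRingType) (X : lmodType R) (x : X).

(** Over [B^c] this is the map b -> xb on the right regular module, and its image is the cyclic
    submodule xB. *)
Definition orbit (b : R^o) : X := (b : R) *: x.

Fact orbit_linear : linear orbit.
Proof. by move=> c a b; rewrite /orbit scalerDl scalerA. Qed.
HB.instance Definition _ := GRing.isLinear.Build R R^o X _ orbit orbit_linear.

End Orbit.

Section Linearity.
Variables (R : pzRingType) (X Y Z : lmodType R).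

Lemma linear_of (f : X -> Y) : linear f -> exists g : {linear X -> Y}, g =1 f.
Proof.
move=> flin; pose H := GRing.isLinear.Build _ _ _ _ f flin.
by exists (HB.pack f H : {linear X -> Y}).
Qed.

(** Injectivity of [h] makes preimages unique, so choosing them pointwise is automatically
    linear. *)
Lemma linear_factor (h : {linear Y -> Z}) (f : {linear X -> Z}) :
    injective h -> (forall x, exists y, h y = f x) ->
  exists g : {linear X -> Y}, forall x, h (g x) = f x.
Proof.
move=> hinj /boolp.choice[g0 hg].
have [c x y|g gE] := linear_of (f := g0).
  by apply: hinj; rewrite linearP !hg linearP.
by exists g => x; rewrite gE hg.
Qed.

End Linearity.

Section Envelope.
Variables (B : pzRingType) (P : rmodType B -> Prop).
Variables (M N : rmodType B) (h : {linear M -> N}).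

Lemma injective_in_bij :
  P M -> injective_in P N -> bijective h -> injective_in P M.
Proof.
move=> PM [_ Ninj] [k hK kK]; split=> // X Y i f PX PY iinj.
have [g gi] := Ninj X Y i (h \o f) PX PY iinj.
(* The inverse [k] is a bare function; linearity of k o g comes from factoring [g] through [h]. *)
have [y|g' hg'] := linear_factor (f := g) (can_inj hK).
  by exists (k (g y)); rewrite kK.
by exists g' => x; apply: (can_inj hK); rewrite hg' gi.
Qed.

(** The kernel of [p] meets the image of [h] trivially, so it vanishes by essentiality; it contains
    every h(p(y)) - y. *)
Lemma essential_retraction (p : {linear N -> M}) :
  essential h -> cancel h p -> cancel p h.
Proof.
move=> hess hK y; apply/eqP; rewrite -subr_eq0; apply/negPn/negP => nz.
have [|m /kerP] := hess (ker p); last by rewrite hK => ->; rewrite linear0 eqxx.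
by exists (h (p y) - y) => //; apply/kerP; rewrite linearB /= hK subrr.
Qed.

(** Extending the identity of M along [h] splits [h]. *)
Lemma essential_bij : P M -> P N -> injective h -> essential h ->
  injective_in P M -> bijective h.
Proof.
move=> PM PN hinj hess [_ /(_ M N h idfun PM PN hinj)[p hK]].
by exists p => //; exact: essential_retraction.
Qed.

End Envelope.

Section Rad.
Variables (B : pzRingType) (C : closedSubcat B).
Let a := rad_ideal C.

Lemma rad_full (X : rmodType B) (x : X) : C X -> x \in rad C X.
Proof.
move=> CX; have /rad_largest : C (submod (im (idfun : {linear X -> X}))).
  exact: im_in.
by apply; apply/imP; exists x.
Qed.

(** The map t -> xt from B to X sends r(B) into r(X). *)
Lemma rad_scale (X : rmodType B) (t : submod a) (x : X) :
  (val t : B^c) *: x \in rad C X.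
Proof.
exact: (rad_map_subproof (orbit x : {linear rregular B -> X})
          (t : submod (rad C (rregular B)))).
Qed.

Hypothesis r_exact : rad_exact C.

Lemma local_unit (X : rmodType B) (x : X) :
  C X -> exists t : submod a, (val t : B^c) *: x = x.
Proof.
move=> CX.
have Cx : C (submod (im (orbit x))) by apply: subcat_sub CX; exact: val_inj.
have [_ _ surj] := r_exact (short_exact_ker (@to_im_surj _ _ _ (orbit x))).
(* As xB is in C, its element x = x1 lies in r(xB) and lifts to some t in r(B). *)
have [t /(congr1 (fun z => val (val z))) /= tE] :=
  surj (Submod (rad_full (to_im (orbit x) 1) Cx)).
by exists t; rewrite -[RHS]scale1r.
Qed.

Section ZetaC.
Variables (M E : rmodType B) (u : {linear M -> E}).

Lemma zeta_inj : C M -> injective u -> injective (zeta a u).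
Proof.
move=> CM uinj; apply: raddf_inj => m zm0.
have [t <-] := local_unit m CM.
by apply: uinj; rewrite linear0 -[LHS]/(zeta a u m t) zm0.
Qed.

(** By right linearity, (fx)(y) = f(xy) = f(x)y. *)
Lemma scale_homI (f : homI a E) (x : submod a) :
  (val x : B^c) *: f = zeta a idfun (f x).
Proof.
apply: homI_ext => y; rewrite homI_scaleE /= -linearZ.
by congr (homI_fun f _); apply: val_inj.
Qed.

Lemma zeta_idfun (m : M) : zeta a idfun (u m) = zeta a u m.
Proof. by apply: homI_ext => x; rewrite /= linearZ. Qed.

Lemma zeta_essential :
  C M -> injective u -> essential u -> essential (zeta a u).
Proof.
move=> CM uinj uess S [f fS f_neq0].
have [x fx_neq0] : exists x, f x != 0.
  apply: contrapT => /forallNP f0; case/eqP: f_neq0.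
  by apply: homI_ext => x; apply/eqP/negPn/negP/f0.
(* The cyclic submodule f(x)B of E is nonzero, so it contains some u(m) = f(x)b different from 0. *)
have [|m /imP[b bE] um] := uess (im (orbit (f x))).
  by exists (f x) => //; apply/imP; exists 1; exact: scale1r.
exists m.
  (* The element (fx)b of S is the image of f(x)b = u(m) in Hom_B(a, E), that is, zeta(m). *)
  have : (b : B^c) *: ((val x : B^c) *: f) \in S by do 2!apply: rpredZ.
  by rewrite scale_homI -linearZ -[_ *: f x]/(orbit (f x) b) bE /= zeta_idfun.
apply: contra_neq um => zm0.
by rewrite (zeta_inj CM uinj (x1 := m) (x2 := 0)) ?linear0.
Qed.

End ZetaC.

Variable E : rmodType B.
Let zetaE : {linear E -> homI a E} := zeta a idfun.

Lemma homI_injective : injective_in C E -> injective_in (@allMod B) (homI a E).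
Proof.
move=> [CE Einj]; split=> // X Y i f _ _ iinj.
have zetaE_inj : injective zetaE by apply: zeta_inj.
have [x|f' f'E] :=
  linear_factor (X := submod (rad C X)) (f := f \o val) zetaE_inj.
  (* Writing x = xt gives f(x) = f(x)t, the image under [zetaE] of the value of f(x) at t. *)
  have [t /(congr1 val) /= <-] := local_unit x (rad_in C X).
  by exists (f (val x) t); rewrite linearZ /= scale_homI.
have [||x y /(congr1 val) /= /iinj /val_inj //|g gE] :=
  Einj _ _ (rad_map (C := C) i) f'; [exact: rad_in | exact: rad_in |].
pose act y t : submod (rad C Y) := Submod (rad_scale t y).
have g_lin y : `[< linear (fun t : submod a => g (act y t)) >].
  apply/asboolP => c s t; rewrite -linearP; congr (g _); apply: val_inj => /=.
  by rewrite scalerDl scalerA.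
have [c y z|h hE] := linear_of (f := fun y => HomI (g_lin y)).
  apply: homI_ext => t; change (g (act (c *: y + z) t) =
    g (act y (@ideal_lmul B a c t)) + g (act z t)).
  rewrite -linearD; congr (g _); apply: val_inj => /=.
  by rewrite scalerDr scalerA.
exists h => x; rewrite hE; apply: homI_ext => t /=.
(* After [zetaE] the right side is f(x)t = f(xt), which is zetaE(f'(xt)) = zetaE(g(i(xt))). *)
apply: zetaE_inj; rewrite -[RHS]scale_homI -linearZ.
rewrite -[RHS](f'E (Submod (rad_scale t x))) -gE.
by congr (zetaE (g _)); apply: val_inj; rewrite /= linearZ.
Qed.

End Rad.

Theorem proposition1p5 (B : pzRingType) (C : closedSubcat B)
    (r_exact : rad_exact C) (M E : rmodType B) (u : {linear M -> E})
    (CM : C M) (hull : injective_envelope C u) :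
  injective_envelope (@allMod B) (zeta (rad_ideal C) u) /\
  (injective_in (@allMod B) M <->
   injective_in C M /\ bijective (zeta (rad_ideal C) u)).
Proof.
have [uinj uess Einj] := hull.
have zinj := zeta_inj r_exact CM uinj.
have zess := zeta_essential r_exact CM uinj uess.
have Hinj := homI_injective r_exact Einj.
split; first by split.
(* A bijective zeta carries injectivity of Hom_B(a, E) back to M; conversely, the essential map zeta
   splits when M is injective. *)
split=> [Minj|[_ zbij]]; last exact: injective_in_bij Hinj zbij.
split; last exact: essential_bij Minj.
by have [_ ext] := Minj; split=> // X Y i f _ _; exact: ext.
Qed.
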